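(* For each of the following quadratic systems, with parameter in the stated range, the limit cycle $\gamma$ given by the (real) oval of the indicated invariant algebraic curve is hyperbolic, i.e. $\int_0^T\left(\frac{\partial P}{\partial x}+\frac{\partial Q}{\partial y}\right)(\gamma(t))\,dt\neq 0$, where $T>0$ is the period of $\gamma$ and $(P,Q)$ is the vector field: (i) $\dot x=6(1+a)x+2y-6(2+a)x^2+12xy$, $\dot y=15(1+a)y+3a(1+a)x^2-2(9+5a)xy+16y^2$, with $0<a<\frac{3}{13}$, and curve $3(1+a)(ax^2+y)^2+2y^2(2y-3(1+a)x)=0$; (ii) $\dot x=5x+6x^2+4(1+a)xy+ay^2$, $\dot y=x+2y+4xy+(2+3a)y^2$, with $\frac{-71+17\sqrt{17}}{32}<a<0$, and curve $x^2+x^3+x^2y+2axy^2+2axy^3+a^2y^4=0$; (iii) $\dot x=2(1+2x-2ax^2+6xy)$, $\dot y=8-3a-14ax-2axy-8y^2$, with $0<a<\frac14$, and curve $\frac14+x-x^2+ax^3+xy+x^2y^2=0$.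
   Context: In each case the indicated curve is invariant under the system and its oval is a limit cycle of the system (a known fact for these parameter ranges). A limit cycle $\gamma$ of period $T$ is called hyperbolic when the integral of the divergence $\partial P/\partial x+\partial Q/\partial y$ along $\gamma$ over one period is nonzero. *)

(* Defs.v *)
From Stdlib Require Import Reals.
From Coquelicot Require Import Coquelicot.
Open Scope R_scope.

Definition divergence (P Q : R -> R -> R) (x y : R) : R :=
  Derive (fun u => P u y) x + Derive (fun v => Q x v) y.

Definition periodic_orbit_on (P Q C : R -> R -> R) (x y : R -> R) (T : R) : Prop :=
  0 < T /\
  (forall t, is_derive x t (P (x t) (y t))) /\
  (forall t, is_derive y t (Q (x t) (y t))) /\
  (forall t, x (t + T) = x t /\ y (t + T) = y t) /\
  (exists t1 t2, x t1 <> x t2 \/ y t1 <> y t2) /\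
  (forall t, C (x t) (y t) = 0).

Definition hyperbolic_cycle (P Q : R -> R -> R) (x y : R -> R) (T : R) : Prop :=
  RInt (fun t => divergence P Q (x t) (y t)) 0 T <> 0.

Definition sysP1 (a x y : R) : R := 6*(1+a)*x + 2*y - 6*(2+a)*x^2 + 12*x*y.
Definition sysQ1 (a x y : R) : R :=
  15*(1+a)*y + 3*a*(1+a)*x^2 - 2*(9+5*a)*x*y + 16*y^2.
Definition curve1 (a x y : R) : R :=
  3*(1+a)*(a*x^2 + y)^2 + 2*y^2*(2*y - 3*(1+a)*x).

Definition sysP2 (a x y : R) : R := 5*x + 6*x^2 + 4*(1+a)*x*y + a*y^2.
Definition sysQ2 (a x y : R) : R := x + 2*y + 4*x*y + (2+3*a)*y^2.
Definition curve2 (a x y : R) : R :=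
  x^2 + x^3 + x^2*y + 2*a*x*y^2 + 2*a*x*y^3 + a^2*y^4.

Definition sysP3 (a x y : R) : R := 2*(1 + 2*x - 2*a*x^2 + 6*x*y).
Definition sysQ3 (a x y : R) : R := 8 - 3*a - 14*a*x - 2*a*x*y - 8*y^2.
Definition curve3 (a x y : R) : R :=
  1/4 + x - x^2 + a*x^3 + x*y + x^2*y^2.

(* Main.v *)
Require Import Defs.
From Stdlib Require Import Reals Lra Psatz ZArith Classical.
From Coquelicot Require Import Coquelicot.
Open Scope R_scope.

(** If [g' = k g] along a periodic orbit, then [g = g(0) exp (int k)], so either
    [g] vanishes identically or [k] has zero integral over a period.  In each
    case the divergence is, modulo the equation of the curve, a linear
    combination of such logarithmic derivatives plus a remainder of constant
    sign which is the square of a function [S] times a nonvanishing factor;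
    [S] vanishes identically only on constant solutions.

    The decompositions come from viewing the curve as a double cover: it is
    quadratic over the coordinate [u = y/x^2], [u = x/y^2], [u = x] respectively,
    the square root of the discriminant is [S] ([tau] in the third case) up to a
    nonvanishing factor, and on the curve [u'] is [S G] up to such a factor,
    where [G' = k G].  In the first two cases the unbounded branch with [u < 0]
    carries no periodic orbit, because the only critical value of [1/u] there
    is its maximum [0]. *)

Ltac rewrite_derive H :=
  match type of H with
  | is_derive ?f ?t ?l =>
      change (Derive (fun s : R => f s) t) with (Derive f t);
      rewrite (is_derive_unique f t l H)
  end.

Lemma is_derive_continuity_pt (f : R -> R) (t l : R) :
  is_derive f t l -> continuity_pt f t.
Proof.
  intros H. apply derivable_continuous_pt. exists l. now apply is_derive_Reals.
Qed.

Lemma derive_zero_const (f : R -> R) :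
  (forall t, is_derive f t 0) -> forall s t, f s = f t.
Proof.
  intros Hf.
  assert (Hlt : forall s t, s < t -> f s = f t).
  { intros s t Hst. apply eq_is_derive; [intros; apply Hf | exact Hst]. }
  intros s t. destruct (Rtotal_order s t) as [H | [H | H]].
  - now apply Hlt.
  - now subst.
  - symmetry. now apply Hlt.
Qed.

Lemma is_derive_RInt_continuous (k : R -> R) (t : R) :
  (forall s, continuous k s) -> is_derive (fun b => RInt k 0 b) t (k t).
Proof.
  intros Hk. apply (is_derive_RInt k (fun b => RInt k 0 b) 0 t).
  - apply filter_forall. intros b. apply @RInt_correct, ex_RInt_continuous.
    intros; apply Hk.
  - apply Hk.
Qed.

Lemma linear_ode_solution (g k : R -> R) :
  (forall t, continuous k t) ->
  (forall t, is_derive g t (k t * g t)) ->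
  forall t, g t = g 0 * exp (RInt k 0 t).
Proof.
  intros Hk Hg t.
  assert (Hc : forall s, is_derive (fun s => g s * exp (- RInt k 0 s)) s 0).
  { intros s.
    evar_last.
    - apply @is_derive_mult; [apply Hg | | intros; apply Rmult_comm].
      apply (is_derive_comp exp (fun s => - RInt k 0 s)).
      + apply is_derive_exp.
      + apply @is_derive_opp, is_derive_RInt_continuous, Hk.
    - unfold plus, mult, scal, opp; simpl. unfold mult; simpl. ring. }
  pose proof (derive_zero_const _ Hc t 0) as H. simpl in H.
  rewrite RInt_point in H. unfold zero in H; simpl in H.
  rewrite Ropp_0, exp_0, Rmult_1_r in H. rewrite <- H.
  rewrite Rmult_assoc, <- exp_plus, Rplus_opp_l, exp_0. ring.
Qed.

Lemma linear_ode_eq0 (g k : R -> R) (t0 : R) :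
  (forall t, continuous k t) ->
  (forall t, is_derive g t (k t * g t)) ->
  g t0 = 0 -> forall t, g t = 0.
Proof.
  intros Hk Hg H0 t.
  rewrite (linear_ode_solution g k Hk Hg t0) in H0.
  rewrite (linear_ode_solution g k Hk Hg t).
  destruct (Rmult_integral _ _ H0) as [H | H].
  - rewrite H. ring.
  - exfalso. pose proof (exp_pos (RInt k 0 t0)). lra.
Qed.

Lemma is_RInt_log_derivative (g k : R -> R) (T : R) :
  (forall t, continuous k t) ->
  (forall t, is_derive g t (k t * g t)) ->
  g 0 <> 0 -> g T = g 0 -> is_RInt k 0 T 0.
Proof.
  intros Hk Hg H0 HT.
  assert (E : RInt k 0 T = 0).
  { apply exp_inv. rewrite exp_0. apply Rmult_eq_reg_l with (g 0); [| exact H0].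
    rewrite <- (linear_ode_solution g k Hk Hg T). lra. }
  assert (H : is_RInt k 0 T (RInt k 0 T)).
  { apply @RInt_correct, ex_RInt_continuous. intros; apply Hk. }
  now rewrite E in H.
Qed.

Lemma nonvanishing_const_sign (f : R -> R) :
  (forall t, continuous f t) -> (forall t, f t <> 0) ->
  (forall t, 0 < f t) \/ (forall t, f t < 0).
Proof.
  intros Hc Hn.
  assert (Hsame : forall s t, 0 < f s -> 0 < f t).
  { intros s t Hs. destruct (Rlt_le_dec 0 (f t)) as [H | H]; [exact H |].
    exfalso.
    destruct (IVT_gen f s t 0) as [c [_ Hc0]].
    - intros u. apply continuity_pt_filterlim, Hc.
    - rewrite Rmin_right, Rmax_left; lra.
    - exact (Hn c Hc0). }
  destruct (Rlt_le_dec 0 (f 0)) as [H | H].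
  - left. intros t. exact (Hsame 0 t H).
  - right. intros t. destruct (Rlt_le_dec (f t) 0) as [Ht | Ht]; [exact Ht |].
    pose proof (Hn t). assert (Hp : 0 < f t) by lra.
    pose proof (Hsame t 0 Hp). lra.
Qed.

Lemma periodic_shift_Z (f : R -> R) (T : R) :
  (forall t, f (t + T) = f t) -> forall (n : Z) t, f (t + IZR n * T) = f t.
Proof.
  intros Hf n. induction n using Z.peano_ind; intros t.
  - f_equal. ring.
  - rewrite succ_IZR. rewrite <- (IHn t), <- (Hf (t + IZR n * T)). f_equal. ring.
  - rewrite <- Z.sub_1_r, minus_IZR. rewrite <- (IHn t).
    rewrite <- (Hf (t + (IZR n - 1) * T)). f_equal. ring.
Qed.

Lemma periodic_representative (f : R -> R) (T : R) :
  0 < T -> (forall t, f (t + T) = f t) ->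
  forall t, exists s, 0 <= s <= T /\ f s = f t.
Proof.
  intros HT Hf t.
  destruct (archimed (t / T)) as [H1 H2].
  exists (t + IZR (1 - up (t / T)) * T). split.
  - rewrite minus_IZR. assert (E : t = t / T * T) by (field; lra).
    split; rewrite E at 1; nra.
  - now apply periodic_shift_Z.
Qed.

Lemma periodic_RInt_pos (r : R -> R) (T : R) :
  0 < T -> (forall t, continuous r t) -> (forall t, r (t + T) = r t) ->
  (forall t, 0 <= r t) -> (exists t, r t <> 0) -> 0 < RInt r 0 T.
Proof.
  intros HT Hc Hper Hpos [t0 Ht0].
  destruct (periodic_representative r T HT Hper t0) as [s [Hs Es]].
  assert (Hex : forall u v, ex_RInt r u v).
  { intros. apply @ex_RInt_continuous. intros; apply Hc. }
  assert (Hmono : forall u v, u <= v -> RInt r 0 u <= RInt r 0 v).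
  { intros u v Huv. rewrite <- (RInt_Chasles r 0 u v) by apply Hex.
    assert (0 <= RInt r u v).
    { apply RInt_ge_0; [exact Huv | apply Hex | intros; apply Hpos]. }
    unfold plus; simpl. lra. }
  destruct (Rlt_le_dec 0 (RInt r 0 T)) as [H | H]; [exact H |].
  exfalso. apply Ht0. rewrite <- Es. clear t0 Ht0 Es.
  assert (Hzero : forall t, 0 <= t <= T -> RInt r 0 t = 0).
  { intros t Ht. pose proof (Hmono 0 t (proj1 Ht)) as H1.
    rewrite RInt_point in H1. unfold zero in H1; simpl in H1.
    pose proof (Hmono t T (proj2 Ht)). lra. }
  assert (Hin : forall t, 0 < t < T -> r t = 0).
  { intros t Ht.
    rewrite <- (is_derive_unique _ _ _ (is_derive_RInt_continuous r t Hc)).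
    apply is_derive_unique, (is_derive_ext_loc (fun _ => 0)).
    - assert (Hd : 0 < Rmin t (T - t)) by (apply Rmin_pos; lra).
      exists (mkposreal _ Hd). intros v Hv.
      unfold ball in Hv; simpl in Hv; unfold AbsRing_ball, abs, minus, plus, opp in Hv;
        simpl in Hv.
      pose proof (Rmin_l t (T - t)). pose proof (Rmin_r t (T - t)).
      apply Rabs_def2 in Hv. symmetry. apply Hzero. lra.
    - apply @is_derive_const. }
  (* the endpoints follow by continuity *)
  destruct (Req_dec (r s) 0) as [E | E]; [exact E |]. exfalso.
  assert (Hp : 0 < r s) by (pose proof (Hpos s); lra).
  pose proof (Hc s) as Hcs. apply continuity_pt_filterlim in Hcs.
  pose proof (proj1 (continuity_pt_locally r s) Hcs) as Hloc.
  destruct (Hloc (mkposreal _ Hp)) as [d Hd]. simpl in Hd.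
  set (e := Rmin (d / 2) (T / 2)).
  assert (0 < e <= T / 2 /\ e < d).
  { pose proof (cond_pos d).
    assert (0 < e) by (apply Rmin_pos; lra).
    pose proof (Rmin_l (d / 2) (T / 2)). pose proof (Rmin_r (d / 2) (T / 2)).
    unfold e in *. lra. }
  assert (Hq : exists q, 0 < q < T /\ Rabs (q - s) < d).
  { destruct (Rle_lt_dec s (T / 2)).
    - destruct (Req_dec s (T/2)).
      + exists s. split; [lra |]. rewrite Rminus_diag, Rabs_R0. lra.
      + exists (s + e). split; [lra |]. rewrite Rabs_pos_eq; lra.
    - exists (s - e). split; [lra |]. rewrite Rabs_left; lra. }
  destruct Hq as [q [Hq1 Hq2]].
  specialize (Hd q Hq2). rewrite (Hin q Hq1) in Hd.
  rewrite Rabs_left in Hd; lra.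
Qed.

Lemma RInt_neq0_of_signed_remainder (D e r : R -> R) (T : R) :
  0 < T -> (forall t, D t = e t + r t) -> is_RInt e 0 T 0 ->
  (forall t, continuous r t) -> (forall t, r (t + T) = r t) ->
  (forall t, 0 <= r t) \/ (forall t, r t <= 0) ->
  (exists t, r t <> 0) -> RInt D 0 T <> 0.
Proof.
  intros HT HD He Hc Hper Hsign [t0 Ht0].
  assert (Hr : ex_RInt r 0 T).
  { apply @ex_RInt_continuous. intros; apply Hc. }
  assert (E : RInt D 0 T = RInt r 0 T).
  { apply is_RInt_unique. rewrite <- (Rplus_0_l (RInt r 0 T)).
    apply (is_RInt_ext (fun t => plus (e t) (r t))); [intros; symmetry; apply HD |].
    apply (is_RInt_plus e r 0 T 0); [exact He | now apply @RInt_correct]. }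
  rewrite E. destruct Hsign as [H | H].
  - apply Rgt_not_eq, periodic_RInt_pos; auto. now exists t0.
  - assert (Ho : 0 < RInt (fun t => opp (r t)) 0 T).
    { apply periodic_RInt_pos; auto.
      - intros t. apply @continuous_opp, Hc.
      - intros t. now rewrite Hper.
      - intros t. unfold opp; simpl. specialize (H t). lra.
      - exists t0. unfold opp; simpl. lra. }
    pose proof (RInt_opp r 0 T Hr) as Eo. unfold opp in Ho, Eo; simpl in Ho, Eo. lra.
Qed.

Lemma periodic_min_critical (w dw : R -> R) (T : R) :
  0 < T -> (forall t, is_derive w t (dw t)) -> (forall t, w (t + T) = w t) ->
  exists c, dw c = 0 /\ forall t, 0 <= t <= T -> w c <= w t.
Proof.
  intros HT Hw Hper.
  destruct (continuity_ab_min w 0 (2 * T)) as [c [Hmin Hc]]; [lra | |].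
  { intros t _. exact (is_derive_continuity_pt _ _ _ (Hw t)). }
  assert (Hex : exists c, 0 < c < 2 * T /\ forall t, 0 <= t <= 2 * T -> w c <= w t).
  { destruct (Req_dec c 0) as [E | E].
    - exists T. split; [lra |]. intros t Ht.
      pose proof (Hper 0) as P0. rewrite Rplus_0_l in P0.
      rewrite P0, <- E. now apply Hmin.
    - destruct (Req_dec c (2 * T)) as [E' | E'].
      + exists T. split; [lra |]. intros t Ht.
        rewrite <- (Hper T). replace (T + T) with c by lra. now apply Hmin.
      + exists c. split; [lra | exact Hmin]. }
  destruct Hex as [d [Hd Hdmin]]. exists d. split.
  - pose proof (proj1 (is_derive_Reals _ _ _) (Hw d)) as Hlim.
    pose (pr := exist (fun l => derivable_pt_lim w d l) (dw d) Hlim : derivable_pt w d).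
    change (derive_pt w d pr = 0).
    apply (deriv_minimum w 0 (2 * T)); [lra | lra |].
    intros t H1 H2. apply Hdmin. lra.
  - intros t Ht. apply Hdmin. lra.
Qed.

Lemma periodic_nonpos_eq0 (w dw : R -> R) (T : R) :
  0 < T -> (forall t, is_derive w t (dw t)) -> (forall t, w (t + T) = w t) ->
  (forall t, w t <= 0) -> (forall t, dw t = 0 -> w t = 0) ->
  forall t, 0 <= t <= T -> w t = 0.
Proof.
  intros HT Hw Hper Hle Hcrit t Ht.
  destruct (periodic_min_critical w dw T HT Hw Hper) as [c [Hc Hmin]].
  specialize (Hmin t Ht). rewrite (Hcrit c Hc) in Hmin. specialize (Hle t). lra.
Qed.

Lemma periodic_derive_zero (w dw : R -> R) (T : R) :
  0 < T -> (forall t, is_derive w t (dw t)) -> (forall t, w (t + T) = w t) ->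
  exists c, 0 <= c <= T /\ dw c = 0.
Proof.
  intros HT Hw Hper.
  destruct (MVT_gen w 0 T dw) as [c [Hc E]].
  - intros; apply Hw.
  - intros t _. exact (is_derive_continuity_pt _ _ _ (Hw t)).
  - rewrite Rmin_left, Rmax_right in Hc by lra. exists c. split; [exact Hc |].
    pose proof (Hper 0) as P0. rewrite Rplus_0_l in P0.
    assert (E0 : dw c * (T - 0) = 0) by lra.
    apply Rmult_integral in E0. lra.
Qed.

Lemma linear_system_eq0 (x y p q r s : R -> R) (t0 : R) :
  (forall t, continuous p t) -> (forall t, continuous q t) ->
  (forall t, continuous r t) -> (forall t, continuous s t) ->
  (forall t, is_derive x t (p t * x t + q t * y t)) ->
  (forall t, is_derive y t (r t * x t + s t * y t)) ->
  x t0 = 0 -> y t0 = 0 -> forall t, x t = 0 /\ y t = 0.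
Proof.
  intros Hp Hq Hr Hs Hx Hy X0 Y0.
  set (M := fun t => p t ^ 2 + (q t + r t) ^ 2 + s t ^ 2 + 3).
  set (N := fun t => x t ^ 2 + y t ^ 2).
  set (dN := fun t => 2 * p t * x t ^ 2 + 2 * (q t + r t) * (x t * y t)
                      + 2 * s t * y t ^ 2).
  assert (HM : forall t, continuous M t).
  { intros t. unfold M.
    assert (Hsq : forall f : R -> R, continuous f t -> continuous (fun t => f t ^ 2) t).
    { intros f Hf. apply (continuous_ext (fun t => mult (f t) (f t))).
      - intros u. unfold mult; simpl. ring.
      - now apply @continuous_mult. }
    apply (continuous_plus (fun t => p t ^ 2 + (q t + r t) ^ 2 + s t ^ 2) (fun _ => 3));
      [| apply continuous_const].
    apply (continuous_plus (fun t => p t ^ 2 + (q t + r t) ^ 2) (fun t => s t ^ 2));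
      [| now apply Hsq].
    apply (continuous_plus (fun t => p t ^ 2) (fun t => (q t + r t) ^ 2));
      [now apply Hsq |].
    apply (Hsq (fun t => q t + r t)). now apply (continuous_plus q r). }
  assert (HN : forall t, is_derive N t (dN t)).
  { intros t. unfold N, dN.
    pose proof (Hx t) as Hxt. pose proof (Hy t) as Hyt.
    auto_derive.
    - repeat split; [now exists (p t * x t + q t * y t) | now exists (r t * x t + s t * y t)].
    - rewrite_derive Hxt. rewrite_derive Hyt. ring. }
  assert (Hb : forall t, - (M t * N t) <= dN t <= M t * N t).
  { intros t. unfold M, N, dN.
    set (k := q t + r t).
    pose proof (pow2_ge_0 (p t * y t)). pose proof (pow2_ge_0 (s t * x t)).
    pose proof (pow2_ge_0 (k * y t)).
    pose proof (pow2_ge_0 (x t)). pose proof (pow2_ge_0 (y t)).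
    split.
    - pose proof (pow2_ge_0 ((p t + 1) * x t)). pose proof (pow2_ge_0 ((s t + 1) * y t)).
      pose proof (pow2_ge_0 (k * x t + y t)). lra.
    - pose proof (pow2_ge_0 ((p t - 1) * x t)). pose proof (pow2_ge_0 ((s t - 1) * y t)).
      pose proof (pow2_ge_0 (k * x t - y t)). lra. }
  assert (Hexp : forall c t, is_derive (fun t => N t * exp (c * RInt M 0 t)) t
                   ((dN t + c * M t * N t) * exp (c * RInt M 0 t))).
  { intros c t. evar_last.
    - apply @is_derive_mult; [apply HN | | intros; apply Rmult_comm].
      apply (is_derive_comp exp (fun t => c * RInt M 0 t)).
      + apply is_derive_exp.
      + apply is_derive_scal, is_derive_RInt_continuous, HM.
    - unfold plus, mult, scal; simpl. unfold mult; simpl. ring. }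
  assert (N0 : N t0 = 0) by (unfold N; rewrite X0, Y0; ring).
  assert (Hle : forall t, N t <= 0).
  { intros t. destruct (Rle_lt_dec t0 t) as [Ht | Ht].
    - destruct (MVT_gen (fun t => N t * exp (-1 * RInt M 0 t)) t0 t
        (fun t => (dN t + -1 * M t * N t) * exp (-1 * RInt M 0 t))) as [c [Hc E]].
      + intros; apply Hexp.
      + intros u _. exact (is_derive_continuity_pt _ _ _ (Hexp _ u)).
      + rewrite N0 in E. pose proof (exp_pos (-1 * RInt M 0 t)).
        pose proof (exp_pos (-1 * RInt M 0 c)). specialize (Hb c).
        assert ((dN c + -1 * M c * N c) * exp (-1 * RInt M 0 c) <= 0) by nra.
        assert (N t * exp (-1 * RInt M 0 t) <= 0) by nra. nra.
    - destruct (MVT_gen (fun t => N t * exp (1 * RInt M 0 t)) t0 t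
        (fun t => (dN t + 1 * M t * N t) * exp (1 * RInt M 0 t))) as [c [Hc E]].
      + intros; apply Hexp.
      + intros u _. exact (is_derive_continuity_pt _ _ _ (Hexp _ u)).
      + rewrite N0 in E. pose proof (exp_pos (1 * RInt M 0 t)).
        pose proof (exp_pos (1 * RInt M 0 c)). specialize (Hb c).
        assert (0 <= (dN c + 1 * M c * N c) * exp (1 * RInt M 0 c)) by nra.
        assert (N t * exp (1 * RInt M 0 t) <= 0) by nra. nra. }
  intros t. specialize (Hle t). unfold N in Hle. split; nra.
Qed.

Lemma is_RInt0_lincomb (f g : R -> R) (c d T : R) :
  is_RInt f 0 T 0 -> is_RInt g 0 T 0 -> is_RInt (fun t => c * f t + d * g t) 0 T 0.
Proof.
  intros Hf Hg. replace 0 with (c * 0 + d * 0) at 2 by ring.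
  apply @is_RInt_plus; now apply @is_RInt_scal.
Qed.

Ltac orbit_side :=
  repeat split; trivial;
  match goal with
  | H : forall t, is_derive ?f t _ |- ex_derive ?f _ => eexists; apply H
  | H : forall t, is_derive ?f t _ |- ex_derive (fun s => ?f s) _ => eexists; apply H
  | _ => idtac
  end.

Ltac orbit_derive Hx Hy t :=
  auto_derive; [orbit_side | rewrite_derive (Hx t); rewrite_derive (Hy t)].

Ltac orbit_continuous := apply @ex_derive_continuous; auto_derive; orbit_side.

Lemma orbit_log_derivative (g dg : R -> R) (T : R) :
  (forall t, is_derive g t (dg t)) -> (forall t, continuous (fun s => dg s / g s) t) ->
  (forall t, g t <> 0) -> g T = g 0 -> is_RInt (fun t => dg t / g t) 0 T 0.
Proof.
  intros Hg Hc Hn HT. apply (is_RInt_log_derivative g); auto.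
  intros t. replace (dg t / g t * g t) with (dg t) by (field; apply Hn). apply Hg.
Qed.

Lemma periodic_orbit_not_constant (P Q C : R -> R -> R) (x y : R -> R) (T : R) :
  periodic_orbit_on P Q C x y T ->
  (forall s t, x s = x t) -> (forall s t, y s = y t) -> False.
Proof.
  intros (_ & _ & _ & _ & (t1 & t2 & [H | H]) & _) Hx Hy; auto.
Qed.

Lemma divergence1 (a x y : R) :
  divergence (sysP1 a) (sysQ1 a) x y = 21 * (1 + a) - (42 + 22 * a) * x + 44 * y.
Proof.
  unfold divergence.
  rewrite (is_derive_unique _ x (6 * (1 + a) - 12 * (2 + a) * x + 12 * y)),
    (is_derive_unique _ y (15 * (1 + a) - 2 * (9 + 5 * a) * x + 32 * y)).
  - ring.
  - unfold sysQ1. auto_derive; [trivial | ring].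
  - unfold sysP1. auto_derive; [trivial | ring].
Qed.

Lemma hyperbolic1 (a : R) (x y : R -> R) (T : R) :
  0 < a -> periodic_orbit_on (sysP1 a) (sysQ1 a) (curve1 a) x y T ->
  hyperbolic_cycle (sysP1 a) (sysQ1 a) x y T.
Proof.
  intros Ha Horb. pose proof Horb as (HT & Hx & Hy & Hper & _ & HC).
  assert (Ex : x T = x 0) by (rewrite <- (Rplus_0_l T); apply Hper).
  assert (Ey : y T = y 0) by (rewrite <- (Rplus_0_l T); apply Hper).
  assert (y0 : forall t, y t <> 0).
  { intros t0 E.
    assert (E' : x t0 = 0).
    { pose proof (HC t0) as H. unfold curve1 in H. rewrite E in H.
      destruct (Req_dec (x t0) 0) as [X | X]; [exact X | exfalso].
      assert (0 < (a * x t0 ^ 2) ^ 2).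
      { apply pow_lt, Rmult_lt_0_compat; [exact Ha | now apply pow2_gt_0]. }
      nra. }
    assert (Z : forall t, x t = 0 /\ y t = 0).
    { apply (linear_system_eq0 x y
        (fun t => 6 * (1 + a) - 6 * (2 + a) * x t + 12 * y t) (fun _ => 2)
        (fun t => 3 * a * (1 + a) * x t - 2 * (9 + 5 * a) * y t)
        (fun t => 15 * (1 + a) + 16 * y t) t0); auto; intros t;
        try orbit_continuous.
      - evar_last; [apply Hx | unfold sysP1; ring].
      - evar_last; [apply Hy | unfold sysQ1; ring]. }
    apply (periodic_orbit_not_constant _ _ _ _ _ _ Horb); intros s t;
      rewrite ?(proj1 (Z s)), ?(proj1 (Z t)), ?(proj2 (Z s)), ?(proj2 (Z t)); reflexivity. }
  set (S := fun t => 4 * y t - 3 * (1 + a) * x t).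
  set (G := fun t => a * x t ^ 2 + y t + 2 * x t * y t).
  set (k := fun t => 21 * (1 + a) + 28 * y t - (30 + 18 * a) * x t
                     + 6 * (1 + a) * a * x t ^ 2 / y t).
  set (v := fun t => x t ^ 2 / y t).
  assert (Hk : forall t, continuous k t).
  { intros t. unfold k. orbit_continuous. }
  assert (HG : forall t, is_derive G t (k t * G t)).
  { intros t. unfold G, k. orbit_derive Hx Hy t.
    apply Rmult_eq_reg_l with (y t); [| apply y0].
    apply Rminus_diag_uniq.
    transitivity (-2 * curve1 a (x t) (y t)); [| rewrite HC; ring].
    unfold sysP1, sysQ1, curve1. field. apply y0. }
  assert (Hv : forall t, is_derive v t (x t * S t * G t / y t ^ 2)).
  { intros t. unfold v, S, G. orbit_derive Hx Hy t.
    unfold sysP1, sysQ1. field. apply y0. }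
  assert (Hvper : forall t, v (t + T) = v t).
  { intros t. unfold v. destruct (Hper t) as [-> ->]. reflexivity. }
  assert (G0 : forall t, G t <> 0).
  { intros t0 E. pose proof (linear_ode_eq0 G k t0 Hk HG E) as Z.
    assert (Ev : forall s t, v s = v t).
    { apply derive_zero_const. intros t. evar_last; [apply Hv |].
      rewrite Z. field. apply y0. }
    assert (Hxv : forall t, x t = - (1 + a * v t) / 2).
    { intros t. specialize (Z t). unfold G in Z.
      apply Rmult_eq_reg_l with (y t); [| apply y0].
      unfold v. field_simplify; [| apply y0]. lra. }
    assert (Ex' : forall s t, x s = x t).
    { intros s t. rewrite (Hxv s), (Hxv t), (Ev s t). reflexivity. }
    apply (periodic_orbit_not_constant _ _ _ _ _ _ Horb Ex').
    intros s t. pose proof (Z s) as Zs. pose proof (Z t) as Zt. unfold G in Zs, Zt.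
    rewrite (Ex' s t) in Zs. apply Rmult_eq_reg_l with (1 + 2 * x t); [lra |].
    intros E1. assert (Exx : x t = - (1 / 2)) by lra. rewrite Exx in Zt. nra. }
  assert (ypos : forall t, 0 < y t).
  { destruct (nonvanishing_const_sign y) as [H | H]; auto.
    - intros t. apply @ex_derive_continuous. eexists; apply Hy.
    - exfalso.
      assert (S0 : forall t, S t <> 0).
      { intros t E. specialize (H t). specialize (HC t). unfold curve1 in HC.
        assert (E1 : (3 * (1 + a) * x t * y t) ^ 2
                     + 12 * (1 + a) * (- y t) * (a * x t ^ 2 + y t) ^ 2
                     = y t ^ 2 * S t ^ 2).
        { apply Rminus_diag_uniq. unfold S.
          transitivity (-4 * y t * 0); [rewrite <- HC; ring | ring]. }
        rewrite E in E1. unfold S in E.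
        assert (0 < (3 * (1 + a) * x t * y t) ^ 2).
        { apply pow2_gt_0. replace (3 * (1 + a) * x t) with (4 * y t) by lra. nra. }
        assert (0 <= 12 * (1 + a) * (- y t) * (a * x t ^ 2 + y t) ^ 2).
        { apply Rmult_le_pos; [nra | apply pow2_ge_0]. }
        lra. }
      assert (Z : forall t, 0 <= t <= T -> v t = 0).
      { apply (periodic_nonpos_eq0 v (fun t => x t * S t * G t / y t ^ 2)); auto.
        - intros t. unfold v. specialize (H t).
          pose proof (pow2_ge_0 (x t)). pose proof (Rinv_lt_0_compat _ H).
          unfold Rdiv. nra.
        - intros t E. unfold Rdiv in E.
          repeat (apply Rmult_integral in E; destruct E as [E | E]).
          + unfold v. rewrite E. field. apply y0.
          + now apply S0 in E.
          + now apply G0 in E.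
          + exfalso. revert E. apply Rinv_neq_0_compat, pow_nonzero, y0. }
      destruct (periodic_derive_zero x (fun t => sysP1 a (x t) (y t)) T) as [c [Hc E]];
        auto.
      { intros t. apply Hper. }
      specialize (Z c Hc).
      assert (x c = 0).
      { apply Rsqr_0_uniq. rewrite Rsqr_pow2.
        replace (x c ^ 2) with (v c * y c) by (unfold v; field; apply y0).
        rewrite Z. ring. }
      unfold sysP1 in E. rewrite H0 in E. specialize (H c). lra. }
  set (B := fun t => (3 + 5 * a) * x t ^ 2 + 2 * y t).
  set (dB := fun t => 2 * (3 + 5 * a) * x t * sysP1 a (x t) (y t)
                      + 2 * sysQ1 a (x t) (y t)).
  assert (B0 : forall t, 0 < B t).
  { intros t. unfold B. specialize (ypos t). nra. }
  assert (B0' : forall t, B t <> 0) by (intros t; apply Rgt_not_eq, B0).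
  apply (RInt_neq0_of_signed_remainder _
    (fun t => 1 * (1 * k t + (-2) * (sysQ1 a (x t) (y t) / y t)) + 2 * (dB t / B t))
    (fun t => 2 * (S t ^ 2 / B t))).
  - exact HT.
  - intros t. rewrite divergence1. unfold S, dB, k. specialize (B0' t). unfold B in *.
    unfold sysP1, sysQ1. field. auto.
  - apply is_RInt0_lincomb; [apply is_RInt0_lincomb |].
    + apply (is_RInt_log_derivative G); auto. unfold G. now rewrite Ex, Ey.
    + apply (orbit_log_derivative y); auto.
      intros t. unfold sysQ1. orbit_continuous.
    + apply (orbit_log_derivative B); auto.
      * intros t. unfold B, dB. orbit_derive Hx Hy t. ring.
      * intros t. specialize (B0' t). unfold B, dB, sysP1, sysQ1 in *. orbit_continuous.
      * unfold B. now rewrite Ex, Ey.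
  - intros t. specialize (B0' t). unfold S, B in *. orbit_continuous.
  - intros t. unfold S, B. destruct (Hper t) as [-> ->]. reflexivity.
  - left. intros t. pose proof (pow2_ge_0 (S t)).
    pose proof (Rinv_0_lt_compat _ (B0 t)). unfold Rdiv. nra.
  - destruct (not_all_ex_not R (fun t => S t = 0)) as [t Ht].
    + intros Z.
      assert (Ev : forall s t, v s = v t).
      { apply derive_zero_const. intros t. evar_last; [apply Hv |].
        rewrite Z. field. apply y0. }
      assert (Hyx : forall t, y t = 3 / 4 * (1 + a) * x t).
      { intros t. specialize (Z t). unfold S in Z. lra. }
      assert (Hxv : forall t, x t = 3 / 4 * (1 + a) * v t).
      { intros t. unfold v. pose proof (y0 t) as Y. rewrite Hyx in Y |- *.
        field. split; intros E; apply Y; rewrite E; ring. }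
      apply (periodic_orbit_not_constant _ _ _ _ _ _ Horb); intros s t.
      * now rewrite (Hxv s), (Hxv t), (Ev s t).
      * now rewrite (Hyx s), (Hyx t), (Hxv s), (Hxv t), (Ev s t).
    + exists t. apply Rmult_integral_contrapositive. split; [lra |].
      apply Rmult_integral_contrapositive.
      split; [now apply pow_nonzero | apply Rinv_neq_0_compat, B0'].
Qed.

Lemma divergence2 (a x y : R) :
  divergence (sysP2 a) (sysQ2 a) x y = 7 + 16 * x + (8 + 10 * a) * y.
Proof.
  unfold divergence.
  rewrite (is_derive_unique _ x (5 + 12 * x + 4 * (1 + a) * y)),
    (is_derive_unique _ y (2 + 4 * x + 2 * (2 + 3 * a) * y)).
  - ring.
  - unfold sysQ2. auto_derive; [trivial | ring].
  - unfold sysP2. auto_derive; [trivial | ring].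
Qed.

Lemma hyperbolic2 (a : R) (x y : R -> R) (T : R) :
  -2 / 3 <= a < 0 -> periodic_orbit_on (sysP2 a) (sysQ2 a) (curve2 a) x y T ->
  hyperbolic_cycle (sysP2 a) (sysQ2 a) x y T.
Proof.
  intros Ha Horb. pose proof Horb as (HT & Hx & Hy & Hper & _ & HC).
  assert (Ex : x T = x 0) by (rewrite <- (Rplus_0_l T); apply Hper).
  assert (Ey : y T = y 0) by (rewrite <- (Rplus_0_l T); apply Hper).
  assert (x0 : forall t, x t <> 0).
  { intros t0 E.
    assert (E' : y t0 = 0).
    { pose proof (HC t0) as H. unfold curve2 in H. rewrite E in H.
      destruct (Req_dec (y t0) 0) as [Y | Y]; [exact Y | exfalso].
      assert (0 < (a * y t0 ^ 2) ^ 2).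
      { apply pow2_gt_0, Rmult_integral_contrapositive.
        split; [lra | now apply pow_nonzero]. }
      nra. }
    assert (Z : forall t, x t = 0 /\ y t = 0).
    { apply (linear_system_eq0 x y
        (fun t => 5 + 6 * x t + 4 * (1 + a) * y t) (fun t => a * y t)
        (fun t => 1 + 4 * y t) (fun t => 2 + (2 + 3 * a) * y t) t0); auto; intros t;
        try orbit_continuous.
      - evar_last; [apply Hx | unfold sysP2; ring].
      - evar_last; [apply Hy | unfold sysQ2; ring]. }
    apply (periodic_orbit_not_constant _ _ _ _ _ _ Horb); intros s t;
      rewrite ?(proj1 (Z s)), ?(proj1 (Z t)), ?(proj2 (Z s)), ?(proj2 (Z t)); reflexivity. }
  set (S := fun t => 2 * x t ^ 2 + x t * y t + 2 * a * y t ^ 3).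
  set (G := fun t => x t + a * y t ^ 2 + 2 * x t * y t).
  set (k := fun t => 7 + 10 * x t + 6 * (1 + a) * y t + 2 * a * y t ^ 2 / x t).
  set (w := fun t => y t ^ 2 / x t).
  assert (Hk : forall t, continuous k t).
  { intros t. unfold k. orbit_continuous. }
  assert (HG : forall t, is_derive G t (k t * G t)).
  { intros t. unfold G, k. orbit_derive Hx Hy t.
    apply Rmult_eq_reg_l with (x t); [| apply x0].
    apply Rminus_diag_uniq.
    transitivity (-2 * curve2 a (x t) (y t)); [| rewrite HC; ring].
    unfold sysP2, sysQ2, curve2. field. apply x0. }
  assert (Hw : forall t, is_derive w t (y t * S t * G t / x t ^ 3)).
  { intros t. unfold w, S, G. orbit_derive Hx Hy t.
    apply Rmult_eq_reg_l with (x t ^ 3); [| apply pow_nonzero, x0].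
    apply Rminus_diag_uniq.
    transitivity (-2 * y t ^ 2 * curve2 a (x t) (y t)); [| rewrite HC; ring].
    unfold sysP2, sysQ2, curve2. field. apply x0. }
  assert (Hwper : forall t, w (t + T) = w t).
  { intros t. unfold w. destruct (Hper t) as [-> ->]. reflexivity. }
  assert (xw : forall t, x t * w t = y t ^ 2) by (intros t; unfold w; field; apply x0).
  assert (G0 : forall t, G t <> 0).
  { intros t0 E. pose proof (linear_ode_eq0 G k t0 Hk HG E) as Z.
    assert (Ew : forall s t, w s = w t).
    { apply derive_zero_const. intros t. evar_last; [apply Hw |].
      rewrite Z. field. apply x0. }
    assert (Hyw : forall t, y t = - (1 + a * w t) / 2).
    { intros t. specialize (Z t). unfold G in Z. rewrite <- xw in Z.
      apply Rmult_eq_reg_l with (x t); [lra | apply x0]. }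
    assert (Ey' : forall s t, y s = y t).
    { intros s t. rewrite (Hyw s), (Hyw t), (Ew s t). reflexivity. }
    refine (periodic_orbit_not_constant _ _ _ _ _ _ Horb _ Ey').
    intros s t. pose proof (Z s) as Zs. pose proof (Z t) as Zt. unfold G in Zs, Zt.
    rewrite (Ey' s t) in Zs. apply Rmult_eq_reg_l with (1 + 2 * y t); [lra |].
    intros E1. assert (Eyy : y t = - (1 / 2)) by lra. rewrite Eyy in Zt. nra. }
  assert (xpos : forall t, 0 < x t).
  { destruct (nonvanishing_const_sign x) as [H | H]; auto.
    - intros t. apply @ex_derive_continuous. eexists; apply Hx.
    - exfalso.
      assert (S0 : forall t, S t <> 0).
      { intros t E. specialize (H t). specialize (HC t). unfold curve2 in HC.
        assert (E1 : (y t * (x t + 2 * a * y t ^ 2)) ^ 2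
                     + 4 * (- x t) * (x t + a * y t ^ 2) ^ 2 = S t ^ 2).
        { apply Rminus_diag_uniq. unfold S.
          transitivity (-4 * x t * 0); [rewrite <- HC; ring | ring]. }
        rewrite E in E1.
        pose proof (pow2_ge_0 (y t * (x t + 2 * a * y t ^ 2))).
        assert (0 < 4 * (- x t) * (x t + a * y t ^ 2) ^ 2).
        { apply Rmult_lt_0_compat; [lra |]. apply pow2_gt_0.
          pose proof (pow2_ge_0 (y t)). nra. }
        lra. }
      assert (Z : forall t, 0 <= t <= T -> w t = 0).
      { apply (periodic_nonpos_eq0 w (fun t => y t * S t * G t / x t ^ 3)); auto.
        - intros t. unfold w. specialize (H t).
          pose proof (pow2_ge_0 (y t)). pose proof (Rinv_lt_0_compat _ H).
          unfold Rdiv. nra.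
        - intros t E. unfold Rdiv in E.
          repeat (apply Rmult_integral in E; destruct E as [E | E]).
          + unfold w. rewrite E. field. apply x0.
          + now apply S0 in E.
          + now apply G0 in E.
          + exfalso. revert E. apply Rinv_neq_0_compat, pow_nonzero, x0. }
      destruct (periodic_derive_zero y (fun t => sysQ2 a (x t) (y t)) T) as [c [Hc E]];
        auto.
      { intros t. apply Hper. }
      assert (Y : y c = 0).
      { apply Rsqr_0_uniq. rewrite Rsqr_pow2, <- xw, (Z c Hc). ring. }
      unfold sysQ2 in E. rewrite Y in E. specialize (H c). lra. }
  assert (yneg : forall t, y t < 0).
  { destruct (nonvanishing_const_sign y) as [H | H]; auto.
    - intros t. apply @ex_derive_continuous. eexists; apply Hy.
    - intros t E. specialize (HC t). specialize (xpos t). unfold curve2 in HC.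
      rewrite E in HC. nra.
    - exfalso.
      destruct (periodic_derive_zero y (fun t => sysQ2 a (x t) (y t)) T) as [c [_ E]];
        auto.
      { intros t. apply Hper. }
      unfold sysQ2 in E. specialize (H c). specialize (xpos c).
      assert (0 < x c * y c) by nra.
      assert (0 <= (2 + 3 * a) * y c ^ 2) by (apply Rmult_le_pos; [lra | apply pow2_ge_0]).
      lra. }
  set (Z1 := fun t => x t + a * y t ^ 2).
  set (Z2 := fun t => x t + (a + 2) * y t ^ 2).
  set (dZ := fun c t => sysP2 a (x t) (y t) + 2 * c * y t * sysQ2 a (x t) (y t)).
  assert (Z1pos : forall t, 0 < Z1 t).
  { intros t. specialize (HC t). specialize (xpos t). specialize (yneg t).
    unfold Z1, curve2 in *.
    assert (E : Rsqr (x t + a * y t ^ 2)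
                + x t * (x t ^ 2 + (- y t) * (- (x t + 2 * a * y t ^ 2))) = 0).
    { rewrite <- HC. unfold Rsqr. ring. }
    pose proof (Rle_0_sqr (x t + a * y t ^ 2)). pose proof (pow2_ge_0 (y t)).
    destruct (Rlt_le_dec 0 (x t + 2 * a * y t ^ 2)) as [H1 | H1]; [nra | exfalso].
    assert (0 <= (- y t) * (- (x t + 2 * a * y t ^ 2))) by (apply Rmult_le_pos; lra).
    assert (0 < x t * (x t ^ 2 + (- y t) * (- (x t + 2 * a * y t ^ 2)))).
    { apply Rmult_lt_0_compat; [exact xpos |]. pose proof (pow_lt (x t) 2 xpos). lra. }
    lra. }
  assert (Z2pos : forall t, 0 < Z2 t).
  { intros t. unfold Z2. specialize (xpos t). pose proof (pow2_ge_0 (y t)). nra. }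
  assert (Z1n : forall t, Z1 t <> 0) by (intros t; apply Rgt_not_eq, Z1pos).
  assert (Z2n : forall t, Z2 t <> 0) by (intros t; apply Rgt_not_eq, Z2pos).
  apply (RInt_neq0_of_signed_remainder _
    (fun t => 1 * (2 * k t + - (2 + 2 / (a + 2)) * (sysP2 a (x t) (y t) / x t))
       + 1 * (1 / 2 * (dZ a t / Z1 t) + (a + 6) / (2 * (a + 2)) * (dZ (a + 2) t / Z2 t)))
    (fun t => G t * (S t ^ 2 / (x t ^ 2 * (Z1 t * Z2 t))))).
  - exact HT.
  - intros t. rewrite divergence2. pose proof (x0 t) as X.
    specialize (Z1n t). specialize (Z2n t).
    apply Rmult_eq_reg_l with (x t ^ 2 * (Z1 t * Z2 t)).
    2: repeat apply Rmult_integral_contrapositive_currified; auto.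
    apply Rminus_diag_uniq.
    transitivity (-2 * (2 * a * y t ^ 4 + (a + 1) * x t * y t ^ 2 + 4 * x t ^ 2 * y t + x t ^ 2)
      * curve2 a (x t) (y t)); [| rewrite HC; ring].
    unfold G, S, dZ, k, Z1, Z2, sysP2, sysQ2, curve2 in *. field.
    repeat split; auto. lra.
  - apply is_RInt0_lincomb; apply is_RInt0_lincomb.
    + apply (is_RInt_log_derivative G); auto. unfold G. now rewrite Ex, Ey.
    + apply (orbit_log_derivative x); auto.
      intros t. unfold sysP2. orbit_continuous.
    + apply (orbit_log_derivative Z1); auto.
      * intros t. unfold Z1, dZ. orbit_derive Hx Hy t. ring.
      * intros t. specialize (Z1n t). unfold Z1, dZ, sysP2, sysQ2 in *. orbit_continuous.
      * unfold Z1. now rewrite Ex, Ey.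
    + apply (orbit_log_derivative Z2); auto.
      * intros t. unfold Z2, dZ. orbit_derive Hx Hy t. ring.
      * intros t. specialize (Z2n t). unfold Z2, dZ, sysP2, sysQ2 in *. orbit_continuous.
      * unfold Z2. now rewrite Ex, Ey.
  - intros t. pose proof (x0 t) as X. specialize (Z1n t). specialize (Z2n t).
    assert (x t ^ 2 * (Z1 t * Z2 t) <> 0).
    { repeat apply Rmult_integral_contrapositive_currified; auto. }
    unfold G, S, Z1, Z2 in *. orbit_continuous.
  - intros t. unfold G, S, Z1, Z2. destruct (Hper t) as [-> ->]. reflexivity.
  - assert (Hq : forall t, 0 <= S t ^ 2 / (x t ^ 2 * (Z1 t * Z2 t))).
    { intros t. apply Rmult_le_pos; [apply pow2_ge_0 |].
      apply Rlt_le, Rinv_0_lt_compat. repeat apply Rmult_lt_0_compat; auto with real. }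
    destruct (nonvanishing_const_sign G) as [H | H]; auto.
    + intros t. apply @ex_derive_continuous. eexists; apply HG.
    + left. intros t. specialize (H t). specialize (Hq t). nra.
    + right. intros t. specialize (H t). specialize (Hq t). nra.
  - destruct (not_all_ex_not R (fun t => S t = 0)) as [t Ht].
    + intros Z.
      assert (Ew : forall s t, w s = w t).
      { apply derive_zero_const. intros t. evar_last; [apply Hw |].
        rewrite Z. field. apply x0. }
      assert (Hxy : forall t, x t = - y t * (1 + 2 * a * w t) / 2).
      { intros t. specialize (Z t). unfold S in Z.
        apply Rmult_eq_reg_l with (x t); [| apply x0].
        replace (y t ^ 3) with (x t * w t * y t) in Z by (rewrite xw; ring). lra. }
      assert (Hyw : forall t, y t = - w t * (1 + 2 * a * w t) / 2).
      { intros t. apply Rmult_eq_reg_l with (y t); [| apply Rlt_not_eq, yneg].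
        replace (y t * y t) with (x t * w t) by (rewrite xw; ring).
        rewrite Hxy at 1. field. }
      assert (Ey' : forall s t, y s = y t).
      { intros s t. now rewrite (Hyw s), (Hyw t), (Ew s t). }
      refine (periodic_orbit_not_constant _ _ _ _ _ _ Horb _ Ey'). intros s t.
      now rewrite (Hxy s), (Hxy t), (Ew s t), (Ey' s t).
    + exists t. apply Rmult_integral_contrapositive. split; [apply G0 |].
      apply Rmult_integral_contrapositive. split; [now apply pow_nonzero |].
      apply Rinv_neq_0_compat. repeat apply Rmult_integral_contrapositive_currified; auto.
Qed.

Lemma divergence3 (a x y : R) :
  divergence (sysP3 a) (sysQ3 a) x y = 4 - 10 * a * x - 4 * y.
Proof.
  unfold divergence.
  rewrite (is_derive_unique _ x (2 * (2 - 4 * a * x + 6 * y))),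
    (is_derive_unique _ y (- 2 * a * x - 16 * y)).
  - ring.
  - unfold sysQ3. auto_derive; [trivial | ring].
  - unfold sysP3. auto_derive; [trivial | ring].
Qed.

Lemma hyperbolic3 (a : R) (x y : R -> R) (T : R) :
  periodic_orbit_on (sysP3 a) (sysQ3 a) (curve3 a) x y T ->
  hyperbolic_cycle (sysP3 a) (sysQ3 a) x y T.
Proof.
  intros Horb. pose proof Horb as (HT & Hx & Hy & Hper & _ & HC).
  assert (Ex : x T = x 0) by (rewrite <- (Rplus_0_l T); apply Hper).
  assert (Ey : y T = y 0) by (rewrite <- (Rplus_0_l T); apply Hper).
  assert (x0 : forall t, x t <> 0).
  { intros t E. specialize (HC t). unfold curve3 in HC. rewrite E in HC. lra. }
  assert (Hconst : (forall t, sysP3 a (x t) (y t) = 0) ->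
    (exists c, forall t, x t * y t + c * x t + 1 / 2 = 0) -> False).
  { intros HP [c Hc]. apply (periodic_orbit_not_constant _ _ _ _ _ _ Horb).
    - apply derive_zero_const. intros t. rewrite <- (HP t). apply Hx.
    - assert (Exs : forall s t, x s = x t).
      { apply derive_zero_const. intros t. rewrite <- (HP t). apply Hx. }
      intros s t. pose proof (Hc s) as Hs. pose proof (Hc t) as Ht.
      rewrite (Exs s t) in Hs. apply Rmult_eq_reg_l with (x t); [lra | apply x0]. }
  set (tau := fun t => x t * y t + 1 / 2).
  set (G := fun t => tau t + 3 * x t).
  set (k := fun t => 12 * y t + 4 + 4 / x t - 6 * a * x t).
  assert (Hk : forall t, continuous k t).
  { intros t. unfold k. orbit_continuous. }
  assert (HP : forall t, x t * sysP3 a (x t) (y t) = 4 * tau t * G t).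
  { intros t. specialize (HC t). unfold sysP3, curve3, G, tau in *. lra. }
  assert (HG : forall t, is_derive G t (k t * G t)).
  { intros t. unfold G, tau, k. orbit_derive Hx Hy t.
    apply Rmult_eq_reg_l with (x t); [| apply x0].
    apply Rminus_diag_uniq.
    transitivity (-8 * curve3 a (x t) (y t)); [| rewrite HC; ring].
    unfold sysP3, sysQ3, curve3. field. apply x0. }
  assert (G0 : forall t, G t <> 0).
  { intros t0 E. apply Hconst.
    - intros t. apply Rmult_eq_reg_l with (x t); [| apply x0].
      rewrite HP, (linear_ode_eq0 G k t0 Hk HG E t). ring.
    - exists 3. intros t. pose proof (linear_ode_eq0 G k t0 Hk HG E t) as E'.
      unfold G, tau in E'. lra. }
  apply (RInt_neq0_of_signed_remainder _
    (fun t => 3 * k t + (-10 / 3) * (sysP3 a (x t) (y t) / x t))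
    (fun t => 16 / 3 * (tau t / x t) ^ 2)).
  - exact HT.
  - intros t. rewrite divergence3.
    apply Rmult_eq_reg_l with (x t ^ 2); [| apply pow_nonzero, x0].
    apply Rminus_diag_uniq.
    transitivity (-16 / 3 * curve3 a (x t) (y t)); [| rewrite HC; ring].
    unfold k, tau, sysP3, curve3. field. apply x0.
  - apply is_RInt0_lincomb.
    + apply (is_RInt_log_derivative G); auto.
      unfold G, tau. now rewrite Ex, Ey.
    + apply (orbit_log_derivative x); auto.
      intros t. unfold sysP3. orbit_continuous.
  - intros t. unfold tau. orbit_continuous.
  - intros t. unfold tau. destruct (Hper t) as [-> ->]. reflexivity.
  - left. intros t. pose proof (pow2_ge_0 (tau t / x t)). lra.
  - destruct (not_all_ex_not R (fun t => tau t = 0)) as [t Ht].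
    + intros Htau. apply Hconst.
      * intros t. apply Rmult_eq_reg_l with (x t); [| apply x0].
        rewrite HP, Htau. ring.
      * exists 0. intros t. specialize (Htau t). unfold tau in Htau. lra.
    + exists t. apply Rmult_integral_contrapositive. split; [lra |].
      apply pow_nonzero, Rmult_integral_contrapositive.
      split; [exact Ht | apply Rinv_neq_0_compat, x0].
Qed.

Theorem theorem6 :
  (forall a : R, 0 < a < 3/13 ->
     forall (x y : R -> R) (T : R),
       periodic_orbit_on (sysP1 a) (sysQ1 a) (curve1 a) x y T ->
       hyperbolic_cycle (sysP1 a) (sysQ1 a) x y T) /\
  (forall a : R, (-71 + 17 * sqrt 17) / 32 < a < 0 ->
     forall (x y : R -> R) (T : R),
       periodic_orbit_on (sysP2 a) (sysQ2 a) (curve2 a) x y T ->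
       hyperbolic_cycle (sysP2 a) (sysQ2 a) x y T) /\
  (forall a : R, 0 < a < 1/4 ->
     forall (x y : R -> R) (T : R),
       periodic_orbit_on (sysP3 a) (sysQ3 a) (curve3 a) x y T ->
       hyperbolic_cycle (sysP3 a) (sysQ3 a) x y T).
Proof.
  split; [| split]; intros a Ha x y T.
  - apply hyperbolic1. lra.
  - apply hyperbolic2.
    assert (4 < sqrt 17).
    { rewrite <- (sqrt_Rsqr 4) by lra. apply sqrt_lt_1; unfold Rsqr; lra. }
    lra.
  - apply hyperbolic3.
Qed.
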